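(* Let $V,W\subset X$ be subspaces and $p=\dim V$. Then $\Theta_{V,W}=\theta_{\Lambda^pV,\Lambda^pW}$, i.e. the Grassmann angle of $V$ with $W$ equals the angle, in the Grassmann algebra $\Lambda X$, between the line $\Lambda^pV$ and the subspace $\Lambda^pW$.
   Context: $X$ is an $n$-dimensional vector space over $\mathbb{R}$ (real case) or $\mathbb{C}$ (complex case) with an inner product $\langle\cdot,\cdot\rangle$ (Hermitian in the complex case, conjugate-linear in the left entry). Subspaces are over the same field, and a line is a 1-dimensional subspace. Principal angles: for nonzero subspaces $V,W$ of an inner product space, with $p=\dim V$, $q=\dim W$, $m=\min\{p,q\}$, there are orthonormal bases $(e_1,\dots,e_p)$ of $V$ and $(f_1,\dots,f_q)$ of $W$ (associated principal bases) and uniquely determined numbers $0\le\theta_1\le\dots\le\theta_m\le\frac{\pi}{2}$ (the principal angles) such that $\langle e_i,f_j\rangle=\delta_{ij}\cos\theta_i$ (equal to $0$ whenever $i\neq j$). Grassmann angle: for nonzero subspaces $V,W\subset X$ with principal angles $\theta_1,\dots,\theta_m$, the Grassmann angle $\Theta_{V,W}\in[0,\frac{\pi}{2}]$ of $V$ with $W$ is $\Theta_{V,W}=\arccos(\cos\theta_1\cdots\cos\theta_m)$ if $\dim V\le\dim W$, and $\Theta_{V,W}=\frac{\pi}{2}$ if $\dim V>\dim W$. Also $\Theta_{\{0\},\{0\}}=\Theta_{\{0\},V}=0$ and $\Theta_{V,\{0\}}=\frac{\pi}{2}$ for $V\ne\{0\}$. Grassmann algebra: $\Lambda X=\bigoplus_p\Lambda^pX$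 has the inner product determined by $\langle v_1\wedge\dots\wedge v_p,w_1\wedge\dots\wedge w_p\rangle=\det(\langle v_i,w_j\rangle)$, with distinct $\Lambda^pX$'s orthogonal, and $\langle\nu,\omega\rangle=\bar\nu\omega$ for scalars $\nu,\omega\in\Lambda^0X$. If $\dim V=p$, then $\Lambda^pV$ is a line in $\Lambda^p X$; $\Lambda^pW=\{0\}$ if $p>\dim W$. For a line $L$ and a subspace $Y$ of an inner product space, the angle $\theta_{L,Y}\in[0,\frac{\pi}{2}]$ is the unique principal angle of $L$ and $Y$ if $Y\neq\{0\}$, and $\theta_{L,\{0\}}=\frac{\pi}{2}$. *)

(* Defs.v *)
(* MathComp and MathComp-Analysis over an arbitrary real number structure
   [R : realType]. *)
From HB Require Import structures.
From mathcomp Require Import all_boot all_order all_algebra all_field.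
From mathcomp Require Import sesquilinear complex.
From mathcomp Require Import all_classical all_reals all_analysis.

Set Implicit Arguments.
Unset Strict Implicit.
Unset Printing Implicit Defensive.

Import Order.TTheory GRing.Theory Num.Theory.
Local Open Scope ring_scope.

(* The two fields of scalars K: R itself and R[i], each with its conjugation
   and its embedding of R. *)
Variant real_or_complex (R : realType) :
    forall K : numFieldType, {rmorphism K -> K} -> (R -> K) -> Prop :=
| RealCase : @real_or_complex R R idfun idfun
| ComplexCase : @real_or_complex R R[i] conjc (real_complex R).

(* [{dot U for conj}] is linear on the left and conjugate-linear on the right;
   [inner] swaps the arguments, to be conjugate-linear on the left. *)
Definition inner (K : numFieldType) (conj : {rmorphism K -> K})
    (U : vectType K) (dotU : {dot U for conj}) (v w : U) : K := dotU w v.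

Section Angles.
Variables (R : realType) (K : numFieldType) (conj : {rmorphism K -> K}).
Variables (ofR : R -> K) (U : vectType K) (dotU : {dot U for conj}).
Implicit Types (V W L Y : {vspace U}) (theta : seq R).

Definition is_principal_angles V W theta : Prop :=
  [/\ size theta = minn (\dim V) (\dim W),
      sorted <=%R theta,
      {in theta, forall t, 0 <= t <= pi / 2} &
      exists (e : (\dim V).-tuple U) (f : (\dim W).-tuple U),
        [/\ basis_of V e /\ orthonormal dotU e,
            basis_of W f /\ orthonormal dotU f &
            forall (i : 'I_(\dim V)) (j : 'I_(\dim W)),
              inner dotU (tnth e i) (tnth f j) =
                if i == j :> nat then ofR (cos theta`_i) else 0]].

Definition principal_angles V W : seq R :=
  xget [::] (is_principal_angles V W).

Definition grassmann_angle V W : R :=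
  if V == 0%VS then 0
  else if W == 0%VS then pi / 2
  else if (\dim V <= \dim W)%N
       then acos (\prod_(t <- principal_angles V W) cos t)
       else pi / 2.

(* Meant for a line L, which has a single principal angle with Y <> 0. *)
Definition line_angle L Y : R :=
  if Y == 0%VS then pi / 2 else head 0 (principal_angles L Y).

End Angles.

(* The Grassmann algebra of X, as an algebra with the universal property of the
   exterior algebra, together with its inner product. The product of the
   algebra is the wedge product, and [expv] builds the p-th exterior power of a
   subspace V as the span of the products of p vectors of V. *)
Definition is_exterior_algebra (K : numFieldType) (X : vectType K)
    (A : falgType K) (iota : 'Hom(X, A)) : Prop :=
  (forall v, iota v * iota v = 0) /\
  (forall (B : algType K) (f : {linear X -> B}), (forall v, f v * f v = 0) ->
     exists2 g : {lrmorphism A -> B}, (forall v, g (iota v) = f v)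
       & forall h : {lrmorphism A -> B}, (forall v, h (iota v) = f v) -> h =1 g).

Definition ext_power (K : numFieldType) (X : vectType K) (A : falgType K)
    (iota : 'Hom(X, A)) (p : nat) (V : {vspace X}) : {vspace A} :=
  ((iota @: V) ^+ p)%VS.

Record grassmann_algebra (K : numFieldType) (conj : {rmorphism K -> K})
    (X : vectType K) (dotX : {dot X for conj}) := GrassmannAlgebra {
  galg :> falgType K;
  ginj : 'Hom(X, galg);
  gdot : {dot galg for conj};
  ginj_exterior : is_exterior_algebra ginj;
  gdot_det : forall (p : nat) (v w : 'I_p -> X),
    inner gdot (\prod_(i < p) ginj (v i)) (\prod_(i < p) ginj (w i)) =
    \det (\matrix_(i < p, j < p) inner dotX (v i) (w j));
  gdot_ortho : forall (p q : nat) (a b : galg), p != q ->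
    a \in ext_power ginj p fullv -> b \in ext_power ginj q fullv ->
    inner gdot a b = 0;
  gdot_scalar : forall nu omega : K,
    inner gdot nu%:A omega%:A = conj nu * omega
}.

(* Main.v *)
Require Import Defs.
From mathcomp Require Import all_boot all_order all_algebra all_field.
From mathcomp Require Import sesquilinear complex.
From mathcomp Require Import all_classical all_reals all_analysis.
From mathcomp Require Import spectral.

Set Implicit Arguments.
Unset Strict Implicit.
Unset Printing Implicit Defensive.

Import Order.TTheory GRing.Theory Num.Theory.
Local Open Scope ring_scope.

(** Both sides are computed from principal bases.  Suppose dim V <= dim W and
let e, f be principal bases of V and W with angles t_i.  Then the orthogonal
projection onto W sends e_i to cos t_i times f_i; equivalently,
<w, e_i> = cos t_i <w, f_i> for every w in W ([principal_vectors]).  Put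
E = e_1 ^ ... ^ e_p and F = f_1 ^ ... ^ f_p.  The determinant formula for the
inner product of the Grassmann algebra turns these relations into
<y, E> = (prod_i cos t_i) <y, F> for every y in the p-th power of W, because
row i of the determinant is multiplied by cos t_i ([dot_wedge_scaled]).  The
same formula shows that E and F are unit vectors and that E spans the p-th
power of V ([ext_power_dim]).  So E projects onto the p-th power of W as
(prod_i cos t_i) F, and the angle of the line with that subspace is the arc
cosine of the factor ([line_angle_eq]).  When dim V > dim W the p-th power of
W vanishes, since a Gram determinant of more vectors than the dimension is
zero ([ext_power_gt_dim]), and both angles are pi / 2.

Principal angles are defined by a choice among admissible lists, so their
existence has to be established, for V and W as well as for the two exterior
powers ([principal_angles_exist]).  The argument is a singular value
decomposition by deflation.  An eigenvector e of the compression to V of the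
projection onto W yields a pair of unit vectors e in V, f in W, each of which
projects on the other subspace to the same nonnegative multiple of the other
([principal_pair]); the orthogonal complements of e in V and of f in W are
then treated by induction, and the pairs are finally sorted by angle.  The
eigenvector comes from a Hermitian matrix; over the reals an eigenvalue is
found in the complex numbers, where it must be real
([hermitian_eigenvalue]).  Identities between wedge products are
obtained from the determinant formula, by checking that a difference has
norm zero. *)

(** * Scalars and Hermitian eigenvalues *)

Section Scalars.
Variables (R : realType) (K : numFieldType) (conj : {rmorphism K -> K}).
Variables (ofR : R -> K) (hK : real_or_complex conj ofR).

Lemma conjK : involutive conj.
Proof. by case: hK => x //=; exact: conjcK. Qed.

Lemma conj_ofR r : conj (ofR r) = ofR r.
Proof. by case: hK => //=; exact: conjc_real. Qed.

Lemma ofR0 : ofR 0 = 0.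
Proof. by case: hK. Qed.

Lemma ofR1 : ofR 1 = 1.
Proof. by case: hK. Qed.

Lemma ofRM r s : ofR (r * s) = ofR r * ofR s.
Proof. by case: hK => //=; exact: rmorphM. Qed.

Lemma ofRB r s : ofR (r - s) = ofR r - ofR s.
Proof. by case: hK => //=; exact: rmorphB. Qed.

Lemma ofR_prod (I : Type) (s : seq I) (P : pred I) (F : I -> R) :
  ofR (\prod_(i <- s | P i) F i) = \prod_(i <- s | P i) ofR (F i).
Proof. exact: (big_morph ofR ofRM ofR1). Qed.

Lemma ofR_ge0 r : (0 <= ofR r) = (0 <= r).
Proof. by case: hK => //=; exact: ler0c. Qed.

Lemma ofR_inj : injective ofR.
Proof. by case: hK => [r s|r s []]. Qed.

Lemma ge0_ofR x : 0 <= x -> exists2 r, 0 <= r & x = ofR r.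
Proof.
case: hK x => [x x0|[a b] /=]; first by exists x.
by rewrite lecE /= => /andP[/eqP-> a0]; exists a.
Qed.

(** The complex numbers are algebraically closed, so only a real symmetric
matrix needs an argument: it has a complex eigenvalue a, with eigenvector u,
and a <u, u> = <u A, u> is its own conjugate.  Hence a is real, and it is a
root of the characteristic polynomial already over R. *)
Lemma hermitian_eigenvalue n (A : 'M[K]_n.+1) :
  (forall i j, A i j = conj (A j i)) -> exists a, eigenvalue A a.
Proof.
case: hK A => A Asym; last exact: (@eigenvalue_closed R[i]).
have [a /eigenvalueP[u uA u0]] :=
  @eigenvalue_closed R[i] n.+1 (map_mx (real_complex R) A) isT.
pose q : R[i] := \sum_i u 0 i * (u 0 i)^*%C.
have aq : a * q = \sum_i \sum_j u 0 j * (A j i)%:C%C * (u 0 i)^*%C.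
  rewrite mulr_sumr; apply: eq_bigr => i _.
  rewrite mulrA; have /matrixP/(_ 0 i) := uA; rewrite !mxE => <-.
  by rewrite mulr_suml; apply: eq_bigr => j _; rewrite mxE.
have q_neq0 : q != 0.
  apply: contra_neq u0 => q0; apply/rowP => i; rewrite mxE.
  have ge0 j : true -> 0 <= u 0 j * (u 0 j)^*%C by move=> _; exact: mul_conjC_ge0.
  have /eqP := psumr_eq0P ge0 q0 (i := i) isT.
  by rewrite mul_conjC_eq0 => /eqP.
have qr : q^*%C = q.
  by rewrite rmorph_sum; apply: eq_bigr => i _; rewrite rmorphM /= conjcK mulrC.
have ar : a^*%C = a.
  apply: (mulIf q_neq0); rewrite -{1}qr -rmorphM aq rmorph_sum exchange_big /=.
  apply: eq_bigr => i _; rewrite rmorph_sum; apply: eq_bigr => j _ /=.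
  have cM (x y : R[i]) : conjc (x * y) = conjc x * conjc y by rewrite rmorphM.
  by rewrite 2!cM conjcK conjc_real Asym mulrC mulrA mulrAC.
have [r ra] : exists r, a = r%:C%C.
  case: a ar {aq uA} => x y [] /eqP; rewrite -subr_eq0 -opprD oppr_eq0.
  by rewrite -mulr2n mulrn_eq0 /= => /eqP->; exists x.
exists r; rewrite eigenvalue_root_char -(fmorph_root (real_complex R)) /=.
rewrite map_char_poly -eigenvalue_root_char; apply/eigenvalueP.
by exists u => //; rewrite uA ra.
Qed.

End Scalars.

(** * Orthonormal bases *)

Section InnerProduct.
Variables (R : realType) (K : numFieldType) (conj : {rmorphism K -> K}).
Variables (ofR : R -> K) (hK : real_or_complex conj ofR).
Variables (U : vectType K) (dotU : {dot U for conj}).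
Implicit Types (u v w e : U) (V W : {vspace U}) (s b : seq U).

Local Notation "''[' u , v ]" := (dotU u v) : ring_scope.

Lemma dot0l u : '[0, u] = 0.
Proof. exact: linear0l. Qed.

Lemma dotBl u v w : '[u - v, w] = '[u, w] - '[v, w].
Proof. exact: linearBl. Qed.

Lemma dotBr u v w : '[w, u - v] = '[w, u] - '[w, v].
Proof. exact: linearBr. Qed.

Lemma dotZl a u v : '[a *: u, v] = a * '[u, v].
Proof. exact: linearZl_LR. Qed.

Lemma dotZr a u v : '[u, a *: v] = conj a * '[u, v].
Proof. exact: linearZr_LR. Qed.

Lemma dot_suml (I : Type) (r : seq I) (F : I -> U) u :
  '[\sum_(i <- r) F i, u] = \sum_(i <- r) '[F i, u].
Proof. exact: linear_sumlz. Qed.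

Lemma dotC u v : '[u, v] = conj '[v, u].
Proof. by rewrite hermC expr0 mul1r. Qed.

Lemma dot_eq0 u : ('[u, u] == 0) = (u == 0).
Proof.
have [->|u0] := eqVneq u 0; first by rewrite dot0l eqxx.
by rewrite gt_eqF // neq0_dnorm_gt0.
Qed.

Lemma dot_ge0 u : 0 <= '[u, u].
Proof.
have [->|u0] := eqVneq u 0; first by rewrite dot0l.
by rewrite ltW // neq0_dnorm_gt0.
Qed.

Lemma mem_perp v u : (u \in orthov dotU <[v]>%VS) = ('[u, v] == 0).
Proof. exact: mem_orthov1. Qed.

Lemma orthonormalP s :
  reflect (uniq s /\ {in s &, forall u v, '[u, v] = (u == v)%:R})
          (orthonormal dotU s).
Proof.
elim: s => [|x s IH]; first by left.
rewrite /orthonormal /= andbT andbACA -andbA -/(orthonormal dotU s).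
apply: (iffP and3P) => [[/eqP xx /allP /= xs /IH[us os]]|[/andP[xs us] os]].
  split=> [|u v].
    rewrite us andbT; apply/negP => /xs /eqP; rewrite xx => /eqP.
    by rewrite oner_eq0.
  rewrite !inE => /predU1P[->|us'] /predU1P[->|vs']; rewrite ?eqxx //; last exact: os.
    rewrite (eqP (xs _ vs')); case: eqP => // xv.
    by move: (xs _ vs'); rewrite -xv xx oner_eq0.
  rewrite dotC (eqP (xs _ us')) rmorph0; case: eqP => // xv.
  by move: (xs _ us'); rewrite xv xx oner_eq0.
split; first by rewrite os ?mem_head ?eqxx.
  apply/allP => y ys /=; rewrite os ?mem_head ?inE ?ys ?orbT //.
  suff -> : (x == y) = false by [].
  by apply: contraNF xs => /eqP->.
by apply/IH; split=> // u v us' vs'; apply: os; rewrite inE ?us' ?vs' orbT.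
Qed.

(** [orthonormal] is defined by recursion on the list; this invariance is what
allows the principal vectors to be sorted by angle. *)
Lemma perm_orthonormal s1 s2 :
  perm_eq s1 s2 -> orthonormal dotU s1 -> orthonormal dotU s2.
Proof.
move=> s12 /orthonormalP[us os]; apply/orthonormalP; split.
  by rewrite -(perm_uniq s12).
by move=> u v; rewrite -!(perm_mem s12); exact: os.
Qed.

Definition onb V s := basis_of V s && orthonormal dotU s.

Lemma perm_onb V s1 s2 : perm_eq s1 s2 -> onb V s1 -> onb V s2.
Proof.
move=> s12 /andP[bs os]; apply/andP; split; last exact: perm_orthonormal os.
by rewrite -(perm_basis _ s12).
Qed.

Lemma onb_size V s : onb V s -> size s = \dim V.
Proof. by case/andP => bs _; rewrite (size_basis (X := in_tuple s) bs). Qed.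

Lemma onb_mem V s v : onb V s -> v \in s -> v \in V.
Proof. by case/andP => bs _; exact: basis_mem. Qed.

Lemma onb_dot V s u v : onb V s -> u \in s -> v \in s -> '[u, v] = (u == v)%:R.
Proof. by case/andP => _ /orthonormalP[_]; apply. Qed.

Lemma onb_nth V s i j : onb V s -> (i < size s)%N -> (j < size s)%N ->
  '[s`_i, s`_j] = (i == j)%:R.
Proof.
move=> bs si sj; rewrite (onb_dot bs) ?mem_nth // nth_uniq //.
by have /andP[_ /orthonormalP[]] := bs.
Qed.

Lemma orthogonal_to_basis V s w :
  basis_of V s -> {in s, forall x, '[w, x] = 0} -> {in V, forall v, '[w, v] = 0}.
Proof.
move=> bs ws v vV; apply/eqP; rewrite dotC fmorph_eq0 -mem_perp.
suff /subvP: (V <= orthov dotU <[w]>)%VS by apply.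
rewrite -(span_basis bs); apply/span_subvP => x xs.
by rewrite mem_perp dotC fmorph_eq0 ws.
Qed.

Definition orthproj b u := \sum_(x <- b) '[u, x] *: x.

Lemma dot_orthproj b u v : '[orthproj b u, v] = \sum_(x <- b) '[u, x] * '[x, v].
Proof.
rewrite /orthproj dot_suml; apply: eq_bigr => x _.
by rewrite dotZl.
Qed.

Lemma orthprojZ b c u : orthproj b (c *: u) = c *: orthproj b u.
Proof.
by rewrite scaler_sumr; apply: eq_bigr => x _; rewrite dotZl scalerA.
Qed.

(** When b is an orthonormal basis of V, [orthproj b] is the orthogonal
projection onto V: u and its image have the same inner products with V. *)
Lemma dot_orthproj_onb V b u : onb V b -> {in V, forall v, '[orthproj b u, v] = '[u, v]}.
Proof.
move=> bV v vV; apply/eqP; rewrite -subr_eq0 -dotBl; apply/eqP.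
have /andP[bs /orthonormalP[ub _]] := bV.
apply: (orthogonal_to_basis bs) vV => y yb.
rewrite dotBl dot_orthproj (bigD1_seq y) //= (onb_dot bV yb yb) eqxx mulr1.
rewrite big_seq_cond big1 ?addr0 ?subrr // => x /andP[xb xy].
by rewrite (onb_dot bV xb yb) (negPf xy) mulr0.
Qed.

Lemma orthproj_in V b u : onb V b -> orthproj b u \in V.
Proof.
by move=> bV; rewrite /orthproj big_seq rpred_sum // => x xb; rewrite rpredZ ?(onb_mem bV).
Qed.

Lemma orthproj_id V b v : onb V b -> v \in V -> orthproj b v = v.
Proof.
move=> bV vV; apply/eqP; rewrite -subr_eq0 -dot_eq0 dotBl; apply/eqP.
by rewrite (dot_orthproj_onb _ bV) ?subrr // rpredB // (orthproj_in _ bV).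
Qed.

(** The deflation step: all inductions on dimension below split off a unit
vector and pass to its orthogonal complement. *)
Lemma onb_cons V e s : e \in V -> '[e, e] = 1 ->
  onb (V :&: orthov dotU <[e]>)%VS s -> onb V (e :: s).
Proof.
move=> eV e1 bs; have es x : x \in s -> x \in V /\ '[x, e] = 0.
  by move/(onb_mem bs); rewrite memv_cap mem_perp => /andP[? /eqP].
have /andP[ss /orthonormalP[us os]] := bs.
have ex x : x \in s -> (e == x) = false.
  by move/es => [_]; case: eqP => // <- /eqP; rewrite e1 oner_eq0.
apply/andP; split; last first.
  apply/orthonormalP; split=> /= [|u v].
    by rewrite us andbT; apply/negP => /ex; rewrite eqxx.
  rewrite !inE => /predU1P[->|us'] /predU1P[->|vs'].
  - by rewrite eqxx.
  - by rewrite dotC (es _ vs').2 rmorph0 ex.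
  - by rewrite (es _ us').2 eq_sym ex.
  - exact: os.
rewrite /basis_of free_cons (basis_free ss) andbT span_cons (span_basis ss).
apply/andP; split; last first.
  by rewrite memv_cap mem_perp e1 oner_eq0 andbF.
rewrite eqEsubv subv_add capvSl -memvE eV /=; apply/subvP => v vV.
apply/memv_addP; exists ('[v, e] *: e); first by rewrite memvZ ?memv_line.
exists (v - '[v, e] *: e); last by rewrite addrC subrK.
rewrite memv_cap rpredB ?rpredZ //= mem_perp dotBl dotZl /=.
by rewrite e1 mulr1 subrr.
Qed.

Lemma dim_deflate V e : e \in V -> '[e, e] = 1 ->
  \dim (V :&: orthov dotU <[e]>)%VS = (\dim V).-1.
Proof.
move=> eV e1; rewrite -eq_dim_orthov1 //; apply/mem_orthovPn.
have ee : '[e, e] != 0 by rewrite e1 oner_eq0.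
by exists e.
Qed.

Lemma normalize u : u != 0 -> exists2 r : R, 0 < r & '[ofR r *: u, ofR r *: u] = 1.
Proof.
move=> u0; have [r r0 ur] := ge0_ofR hK (dot_ge0 u).
have rn0 : r != 0 by apply: contraNneq u0 => r0'; rewrite -dot_eq0 ur r0' (ofR0 hK).
have rgt0 : 0 < r by rewrite lt_neqAle eq_sym rn0.
exists (Num.sqrt r)^-1; first by rewrite invr_gt0 sqrtr_gt0.
rewrite dotZl dotZr (conj_ofR hK) ur -!(ofRM hK) mulrA -invfM.
by rewrite -expr2 sqr_sqrtr // mulVf // (ofR1 hK).
Qed.

Lemma unit_vector V : V != 0%VS -> exists2 e, e \in V & '[e, e] = 1.
Proof.
rewrite -vpick0 => /normalize[r _ r1]; exists (ofR r *: vpick V) => //.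
by rewrite memvZ ?memv_pick.
Qed.

Lemma onb_exists V : exists s, onb V s.
Proof.
have [n] := ubnP (\dim V); elim: n V => // n IH V; rewrite ltnS => Vn.
have [->|V0] := eqVneq V 0%VS.
  by exists [::]; rewrite /onb /basis_of span_nil eqxx nil_free.
have [e eV e1] := unit_vector V0.
have [|s bs] := IH (V :&: orthov dotU <[e]>)%VS.
  by rewrite dim_deflate // prednK ?lt0n ?dimv_eq0.
by exists (e :: s); exact: onb_cons.
Qed.

(** In an orthonormal basis a of V, the map e |-> P e followed by projection to
V, with P = [orthproj b], has matrix <P a_i, a_j>, which is Hermitian for any
list b since <P u, v> is the sum of the <u, x> <x, v> over x in b.  The
conclusion says that P e - lam e is orthogonal to V, so that e is an
eigenvector of the compression. *)
Lemma compression_eigenvector V b : V != 0%VS ->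
  exists e lam, [/\ e \in V, '[e, e] = 1 &
    {in V, forall v, '[orthproj b e, v] = lam * '[e, v]}].
Proof.
move=> V0; have [a aV] := onb_exists V.
have sa := onb_size aV; have /andP[ba _] := aV.
have [n dV] : exists n, \dim V = n.+1.
  by exists (\dim V).-1; rewrite prednK // lt0n dimv_eq0.
pose A := \matrix_(i < n.+1, j < n.+1) '[orthproj b a`_i, a`_j].
have Aherm i j : A i j = conj (A j i).
  rewrite !mxE !dot_orthproj rmorph_sum; apply: eq_bigr => x _ /=.
  by rewrite rmorphM -!dotC mulrC.
have [lam /eigenvalueP[u uA u0]] := hermitian_eigenvalue hK Aherm.
pose e := \sum_i u 0 i *: a`_i.
have ea (j : 'I_n.+1) : '[e, a`_j] = u 0 j.
  rewrite /e dot_suml (bigD1 j) //= dotZl /= (onb_nth aV) ?sa ?dV //.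
  rewrite eqxx mulr1 big1 ?addr0 // => i ij.
  by rewrite dotZl /= (onb_nth aV) ?sa ?dV // val_eqE (negPf ij) mulr0.
have e0 : e != 0.
  apply: contra_neq u0 => e0; apply/rowP => j.
  by rewrite mxE -ea e0 dot0l.
have eV : e \in V.
  by rewrite rpred_sum // => i _; rewrite rpredZ // (onb_mem aV) // mem_nth // sa dV.
have eP : {in V, forall v, '[orthproj b e, v] = lam * '[e, v]}.
  move=> v vV; apply/eqP; rewrite -subr_eq0 -dotZl -dotBl; apply/eqP.
  apply: (orthogonal_to_basis ba) vV => x xa.
  have jn : (index x a < n.+1)%N by rewrite -dV -sa index_mem.
  rewrite -(nth_index 0 xa) -[index x a]/(val (Ordinal jn)); set j := Ordinal jn.
  rewrite dotBl dotZl ea /=; have /matrixP/(_ 0 j) := uA.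
  rewrite !mxE => <-; apply/eqP; rewrite subr_eq0 dot_orthproj; apply/eqP.
  under [RHS]eq_bigr => i _ do rewrite mxE dot_orthproj mulr_sumr.
  rewrite exchange_big; apply: eq_bigr => y _ /=.
  rewrite dot_suml mulr_suml; apply: eq_bigr => i _.
  by rewrite dotZl mulrA.
have [r r0 r1] := normalize e0.
exists (ofR r *: e), lam; split=> //; first by rewrite rpredZ.
by move=> v vV; rewrite orthprojZ !dotZl /= eP // mulrCA.
Qed.

End InnerProduct.

(** * Principal angles *)

Section PrincipalAngles.
Variables (R : realType) (K : numFieldType) (conj : {rmorphism K -> K}).
Variables (ofR : R -> K) (hK : real_or_complex conj ofR).
Variables (U : vectType K) (dotU : {dot U for conj}).
Implicit Types (u v w e f : U) (V W : {vspace U}) (s b : seq U).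

Local Notation "''[' u , v ]" := (dotU u v) : ring_scope.

Lemma acos_pihalf (x : R) : 0 <= x <= 1 -> 0 <= acos x <= pi / 2 /\ cos (acos x) = x.
Proof.
move=> /andP[x0 x1]; have xN1 : -1 <= x <= 1 by rewrite x1 (le_trans _ x0) ?lerN10.
have [/andP[a0 api] ca] := acos_def xN1; split=> //; rewrite a0 leNgt.
apply/negP => lt_a; have : cos (acos x) < cos (pi / 2).
  rewrite ltr_cos ?in_itv /= ?a0 ?api //.
  by rewrite divr_ge0 ?pi_ge0 //= ler_pdivrMr // ler_peMr ?pi_ge0 // ler1n.
by rewrite ca cos_pihalf ltNge x0.
Qed.

(** Each orthogonality condition lowers the dimension by at most one. *)
Lemma exists_perp s W : (size s < \dim W)%N ->
  exists f, [/\ f \in W, '[f, f] = 1 & {in s, forall x, '[f, x] = 0}].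
Proof.
elim: s W => [|x s IH] W /= sW.
  have [|f fW f1] := unit_vector hK dotU (V := W); last by exists f.
  by rewrite -dimv_eq0 -lt0n.
have [|f [fW f1 fs]] := IH (W :&: orthov dotU <[x]>)%VS.
  by rewrite (leq_trans _ (leq_dim_orthov1 _ _ _)) // -ltnS prednK // (leq_ltn_trans _ sW).
move: fW; rewrite memv_cap mem_perp => /andP[fW /eqP fx].
by exists f; split=> // y; rewrite inE => /predU1P[->|/fs].
Qed.

(** The singular vectors for one singular value.  Let P be the projection onto
W and e a unit eigenvector of the compression of P to V.  Its eigenvalue is
r = |P e|^2 >= 0.  If r > 0, then f = P e / sqrt r works with cosine sqrt r.  If
r = 0, then e is orthogonal to W and the cosine is 0; the vector f must then
be orthogonal to V.  It exists because orthogonality to e is automatic in W,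
which leaves dim V - 1 < dim W conditions. *)
Lemma principal_pair V W : V != 0%VS -> (\dim V <= \dim W)%N ->
  exists e f t, [/\ e \in V /\ '[e, e] = 1, f \in W /\ '[f, f] = 1,
    0 <= t <= pi / 2,
    {in W, forall w, '[w, e] = ofR (cos t) * '[w, f]} &
    {in V, forall v, '[v, f] = ofR (cos t) * '[v, e]}].
Proof.
move=> V0 VW; have [b bW] := onb_exists hK dotU W.
suff [e [f [r [[eV e1] [fW f1] r0 eW fV]]]] : exists e f r,
    [/\ e \in V /\ '[e, e] = 1, f \in W /\ '[f, f] = 1, 0 <= r,
    {in W, forall w, '[w, e] = ofR r * '[w, f]} &
    {in V, forall v, '[v, f] = ofR r * '[v, e]}].
  have fe : '[f, e] = ofR r by rewrite eW // f1 mulr1.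
  have ef : '[e, f] = ofR r by rewrite fV // e1 mulr1.
  (* |e - r f|^2 = 1 - r^2. *)
  have r1 : r <= 1.
    have := dot_ge0 dotU (e - ofR r *: f).
    rewrite dotBl !dotBr !dotZl !dotZr e1 ef fe f1 (conj_ofR hK) mulr1 subrr.
    rewrite subr0 -(ofRM hK) -(ofR1 hK) -(ofRB hK) (ofR_ge0 hK) subr_ge0.
    by rewrite -expr2 expr_le1.
  have [|t12 ct] := @acos_pihalf r; first by rewrite r0.
  by exists e, f, (acos r); rewrite ct.
have [e [lam [eV e1 eP]]] := compression_eigenvector hK dotU b V0.
set Pe := orthproj dotU b e in eP.
have PeW : Pe \in W by exact: orthproj_in bW.
have wP w : w \in W -> '[w, Pe] = '[w, e].
  by move=> wW; rewrite dotC (dot_orthproj_onb _ bW) // -dotC.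
have [r r0 lamr] : exists2 r, 0 <= r & lam = ofR r.
  apply: (ge0_ofR hK); suff -> : lam = '[Pe, Pe] by exact: dot_ge0.
  by rewrite wP // eP // e1 mulr1.
have Pe2 : '[Pe, Pe] = ofR r by rewrite wP // eP // e1 mulr1.
have [r00|rn0] := eqVneq r 0.
  have Pe0 : Pe = 0 by apply/eqP; rewrite -(dot_eq0 dotU) Pe2 r00 (ofR0 hK).
  have eW w : w \in W -> '[w, e] = 0.
    by move=> wW; rewrite -wP // Pe0 dotC dot0l rmorph0.
  have [a aV] := onb_exists hK dotU (V :&: orthov dotU <[e]>)%VS.
  have [|f [fW f1 fa]] := @exists_perp a W.
    rewrite (onb_size aV) dim_deflate // (leq_trans _ VW) // prednK //.
    by rewrite lt0n dimv_eq0.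
  have /andP[ea _] := onb_cons eV e1 aV.
  exists e, f, 0; split=> // [w wW|v vV]; rewrite (ofR0 hK) mul0r; first exact: eW.
  rewrite dotC (orthogonal_to_basis ea _ vV) ?rmorph0 // => x.
  by rewrite inE => /predU1P[->|/fa//]; exact: eW.
have rgt0 : 0 < r by rewrite lt_neqAle eq_sym rn0.
have sr0 : Num.sqrt r != 0 by rewrite gt_eqF // sqrtr_gt0.
have rr : r = Num.sqrt r * Num.sqrt r by rewrite -expr2 sqr_sqrtr.
exists e, (ofR (Num.sqrt r)^-1 *: Pe), (Num.sqrt r); split=> //.
- split; first by rewrite rpredZ.
  rewrite dotZl dotZr (conj_ofR hK) Pe2 -!(ofRM hK) {3}rr mulKf // mulVf //.
  exact: ofR1 hK.
- move=> w wW; rewrite dotZr (conj_ofR hK) mulrA -(ofRM hK) divff //.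
  by rewrite (ofR1 hK) mul1r wP.
- move=> v vV; rewrite dotZr (conj_ofR hK) dotC eP // rmorphM lamr /=.
  by rewrite (conj_ofR hK) -dotC mulrA -(ofRM hK) {2}rr mulKf.
Qed.

(** A triple (e, f, t) in l consists of two paired principal vectors and their
angle; g completes the second vectors to a basis of W.  The pairing is stated
through inner products with all of W rather than with the other f's, so that
it does not depend on the order of l and survives the passage from the
complement of f to W. *)
Lemma principal_triples V W : (\dim V <= \dim W)%N ->
  exists (l : seq (U * U * R)) (g : seq U),
    [/\ onb dotU V [seq x.1.1 | x <- l],
        onb dotU W ([seq x.1.2 | x <- l] ++ g) &
        {in l, forall x, 0 <= x.2 <= pi / 2 /\
          {in W, forall w, '[w, x.1.1] = ofR (cos x.2) * '[w, x.1.2]}}].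
Proof.
have [n] := ubnP (\dim V); elim: n V W => // n IH V W; rewrite ltnS => Vn VW.
have [V0|V0] := eqVneq V 0%VS.
  have [g gW] := onb_exists hK dotU W; exists [::], g; split=> //.
  by rewrite V0 /onb /basis_of span_nil eqxx nil_free.
have [e [f [t [[eV e1] [fW f1] t12 eW fV]]]] := principal_pair V0 VW.
pose V' := (V :&: orthov dotU <[e]>)%VS; pose W' := (W :&: orthov dotU <[f]>)%VS.
have dV' : \dim V' = (\dim V).-1 by rewrite dim_deflate.
have dW' : \dim W' = (\dim W).-1 by rewrite dim_deflate.
have dV0 : (0 < \dim V)%N by rewrite lt0n dimv_eq0.
have [||l [g [lV lW lP]]] := IH V' W'.
- by rewrite dV' prednK.
- by rewrite dV' dW' -!subn1 leq_sub2r.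
exists ((e, f, t) :: l), g; split=> /=; [exact: onb_cons|exact: onb_cons|].
move=> x; rewrite inE => /predU1P[->|xl] //.
have [x12 xW] := lP _ xl; split=> // w wW.
have : x.1.1 \in V' by apply: (onb_mem lV); apply: map_f.
have : x.1.2 \in W' by apply: (onb_mem lW); rewrite mem_cat (map_f (fun x => x.1.2)).
rewrite !memv_cap !mem_perp => /andP[fxW /eqP fx] /andP[exV /eqP ex].
have w'W : w - '[w, f] *: f \in W'.
  rewrite memv_cap mem_perp rpredB ?rpredZ //=.
  by rewrite dotBl dotZl f1 mulr1 subrr.
have := xW _ w'W; rewrite !dotBl !dotZl [ '[f, x.1.2] ]dotC fx rmorph0 mulr0 subr0 => <-.
by rewrite [ '[f, _] ]dotC (fV _ exV) ex mulr0 rmorph0 mulr0 subr0.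
Qed.

Lemma principal_angles_exist V W : (\dim V <= \dim W)%N ->
  exists theta, is_principal_angles ofR dotU V W theta.
Proof.
move=> VW; have [l0 [g [l0V l0W l0P]]] := principal_triples VW.
pose l := sort (relpre (fun x : U * U * R => x.2) <=%R) l0.
have l_l0 : perm_eq l0 l by rewrite perm_sym perm_sort.
have lV := perm_onb (perm_map _ l_l0) l0V.
have lW : onb dotU W ([seq x.1.2 | x <- l] ++ g).
  by apply: perm_onb l0W; rewrite perm_cat2r perm_map.
have sl : size l = \dim V by rewrite -(onb_size lV) size_map.
exists [seq x.2 | x <- l]; split.
- by rewrite size_map sl (minn_idPl VW).
- by rewrite sorted_map sort_sorted // => x y; exact: le_total.
- by move=> _ /mapP[x xl ->]; have [] := l0P x; rewrite ?(perm_mem l_l0).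
exists (Tuple (introT eqP (onb_size lV))), (Tuple (introT eqP (onb_size lW))).
split; [exact/andP|exact/andP|] => i j; rewrite /inner !(tnth_nth 0) /=.
pose x0 : U * U * R := (0, 0, 0); have il : (i < size l)%N by rewrite sl.
have ilW : (i < size ([seq x.1.2 | x <- l] ++ g))%N.
  by rewrite (onb_size lW) (leq_trans _ VW).
have jlW : (j < size ([seq x.1.2 | x <- l] ++ g))%N by rewrite (onb_size lW).
have lf : ([seq x.1.2 | x <- l] ++ g)`_i = (nth x0 l i).1.2.
  by rewrite nth_cat size_map il (nth_map x0).
have [_ xW] : 0 <= (nth x0 l i).2 <= pi / 2 /\
    {in W, forall w, '[w, (nth x0 l i).1.1] =
      ofR (cos (nth x0 l i).2) * '[w, (nth x0 l i).1.2]}.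
  by apply: l0P; rewrite (perm_mem l_l0) mem_nth.
rewrite !(nth_map x0) // xW ?(onb_mem lW) ?mem_nth // -lf.
by rewrite (onb_nth lW) // eq_sym; case: eqP => _; rewrite ?mulr1 ?mulr0.
Qed.

(** The projection of e_i onto W is cos theta_i f_i: expand w in the basis f. *)
Lemma principal_vectors V W theta : (\dim V <= \dim W)%N ->
  is_principal_angles ofR dotU V W theta ->
  exists e f : seq U, [/\ onb dotU V e, onb dotU W f &
    forall i, (i < \dim V)%N -> {in W, forall w,
      '[w, e`_i] = ofR (cos theta`_i) * '[w, f`_i]}].
Proof.
move=> VW [_ _ _ [e [f [[be oe] [bf of_] ef]]]].
have eV : onb dotU V e by apply/andP.
have fW : onb dotU W f by apply/andP.
exists e, f; split=> // i iV w wW.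
have iW : (i < \dim W)%N by exact: leq_trans VW.
rewrite -{1}(orthproj_id fW wW) dot_orthproj (big_nth 0) size_tuple big_mkord.
rewrite (bigD1 (Ordinal iW)) //= big1 ?addr0 => [|j ij].
  have := ef (Ordinal iV) (Ordinal iW).
  by rewrite /inner !(tnth_nth 0) /= eqxx => ->; rewrite mulrC.
have := ef (Ordinal iV) j; rewrite /inner !(tnth_nth 0) /= => ->.
by rewrite eq_sym -val_eqE /= in ij; rewrite (negPf ij) mulr0.
Qed.

(** The hypothesis says that E projects onto W as c F.  For any principal
vectors e_0, f_0 of the pair, E = a e_0 with |a| = 1, so c F is also
a cos t f_0; comparing norms gives c = cos t.  Thus the angle is determined
without completing F to a principal basis of W. *)
Lemma line_angle_eq V W E F (c : R) : \dim V = 1%N ->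
  E \in V -> '[E, E] = 1 -> F \in W -> '[F, F] = 1 -> 0 <= c ->
  {in W, forall w, '[w, E] = ofR c * '[w, F]} ->
  line_angle ofR dotU V W = acos c.
Proof.
move=> V1 EV E1 FW F1 c0 EF; rewrite /line_angle.
have F0 : F != 0 by rewrite -(dot_eq0 dotU) F1 oner_eq0.
have W0 : W != 0%VS.
  by apply: contraNneq F0 => W0; rewrite W0 memv0 in FW.
have VW : (\dim V <= \dim W)%N by rewrite V1 lt0n dimv_eq0.
rewrite (negPf W0) /principal_angles; case: xgetP => [theta _|none]; last first.
  by have [theta /none] := principal_angles_exist VW.
move=> th; have [size_th _ th_bound _] := th.
have [e [f [eV fW ef]]] := principal_vectors VW th.
rewrite V1 (minn_idPl _) -?V1 // V1 in size_th.
case: theta th_bound size_th ef {th} => [|t []] //= th_bound _ ef.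
have /andP[t0 t1] := th_bound t (mem_head _ _).
have te : {in W, forall w, '[w, e`_0] = ofR (cos t) * '[w, f`_0]}.
  by apply: (ef 0%N); rewrite V1.
have f0W : f`_0 \in W by rewrite (onb_mem fW) // mem_nth // (onb_size fW) -V1.
have Ee : E = '[E, e`_0] *: e`_0.
  rewrite -{1}(orthproj_id eV EV) /orthproj.
  by case: (e) (onb_size eV) => [|x []] //=; rewrite V1 // big_seq1.
set a := '[E, e`_0] in Ee.
have e01 : '[e`_0, e`_0] = 1 by rewrite (onb_nth eV) // (onb_size eV) V1.
have aa : a * conj a = 1.
  by move: E1; rewrite Ee dotZl dotZr e01 mulr1.
pose k := ofR (cos t).
have ck w : w \in W -> conj a * (k * '[w, f`_0]) = ofR c * '[w, F].
  by move=> wW; rewrite -EF // Ee dotZr te.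
have f01 : '[f`_0, f`_0] = 1 by rewrite (onb_nth fW) // (onb_size fW) -V1.
have := ck _ f0W; rewrite f01 mulr1 => kf.
have := congr1 conj (ck _ FW); rewrite F1 mulr1 !rmorphM /= (conjK hK).
rewrite !(conj_ofR hK) -dotC => kF.
(* Multiplying [kf] by [kF] eliminates <f_0, F> and leaves c^2 = k^2. *)
have ct : c = cos t.
  apply/eqP; rewrite -(eqrXn2 (n := 2)) //; last first.
    by rewrite cos_ge0_pihalf // t1 (le_trans _ t0) // oppr_le0 divr_ge0 ?pi_ge0.
  apply/eqP/(ofR_inj hK); rewrite !expr2 !(ofRM hK) -{1}kF -/k.
  by rewrite mulrA -(mulrA (a * k)) (mulrC _ (ofR c)) -kf mulrACA aa mul1r.
rewrite ct cosK // in_itv /= t0 (le_trans t1) //.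
by rewrite ler_pdivrMr // ler_peMr ?pi_ge0 // ler1n.
Qed.

End PrincipalAngles.

(** * Exterior powers of subspaces *)

Section GrassmannAlgebra.
Variables (R : realType) (K : numFieldType) (conj : {rmorphism K -> K}).
Variables (ofR : R -> K) (hK : real_or_complex conj ofR).
Variables (X : vectType K) (dotX : {dot X for conj}).
Variable (Lambda : grassmann_algebra dotX).
Implicit Types (V W : {vspace X}) (Z : {vspace Lambda}).

Local Notation ext := (ext_power (ginj Lambda)).

Definition wedge p (v : 'I_p -> X) : Lambda := \prod_(i < p) ginj Lambda (v i).

Lemma dot_wedge p (v w : 'I_p -> X) :
  gdot Lambda (wedge v) (wedge w) = \det (\matrix_(i, j) dotX (v j) (w i)).
Proof. exact: gdot_det. Qed.

Lemma wedge_in p (v : 'I_p -> X) V :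
  (forall i, v i \in V) -> wedge v \in ext p V.
Proof.
elim: p v => [|p IH] v vV; rewrite /wedge /ext_power.
  by rewrite big_ord0 expv0 memv_line.
by rewrite big_ord_recl expvSl memv_mul ?memv_img // IH.
Qed.

Lemma ext_power_sub p V Z :
  (forall v : 'I_p -> X, (forall i, v i \in V) -> wedge v \in Z) ->
  (ext p V <= Z)%VS.
Proof.
elim: p Z => [|p IH] Z vZ; rewrite /ext_power.
  rewrite expv0 -memvE; have := vZ (fun=> 0); rewrite /wedge big_ord0.
  by apply; case.
rewrite expvSl; apply/prodvP => _ y /memv_imgP[x xV ->] yV.
(* Induction applied to the subspace of the y such that x ^ y is in Z. *)
suff /subvP/(_ y yV) : (ext p V <= amull (ginj Lambda x) @^-1: Z)%VS.
  by rewrite -memv_preim lfunE.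
apply: IH => v vV; rewrite -memv_preim lfunE /=.
pose v' (i : 'I_p.+1) := if unlift ord0 i is Some j then v j else x.
have := vZ v'; rewrite /wedge big_ord_recl /v' unlift_none.
under eq_bigr => i _ do rewrite liftK.
by apply=> i; case: unliftP => [j _|_].
Qed.

(** The squared norm of a wedge product of p vectors of V is their Gram
determinant.  Expanding them in an orthonormal basis of V factors the Gram
matrix through a space of dimension dim V < p, so it is singular. *)
Lemma ext_power_gt_dim p V : (\dim V < p)%N -> ext p V = 0%VS.
Proof.
move=> Vp; apply/eqP; rewrite -subv0; apply: ext_power_sub => v vV.
have [b bV] := onb_exists hK dotX V; have sb := onb_size bV.
rewrite memv0 -(dot_eq0 (gdot Lambda)) dot_wedge.
set G := \matrix_(i, j) _.
have GE : G = \matrix_(i < p, k < size b) conj (dotX (v i) b`_k) *m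
              \matrix_(k < size b, j < p) dotX (v j) b`_k.
  apply/matrixP => i j; rewrite !mxE -{1}(orthproj_id bV (vV j)) dot_orthproj.
  rewrite (big_nth 0) big_mkord; apply: eq_bigr => k _.
  by rewrite !mxE mulrC -dotC.
apply: contraTT Vp => detG; rewrite -leqNgt -sb.
have : G \in unitmx by rewrite unitmxE unitfE.
rewrite -row_free_unit => /eqP <-; rewrite GE.
by rewrite (leq_trans (mxrankM_maxl _ _)) // rank_leq_col.
Qed.

Lemma dot_wedge_onb p V b : onb dotX V b -> (p <= size b)%N ->
  gdot Lambda (wedge (fun i : 'I_p => b`_i)) (wedge (fun i : 'I_p => b`_i)) = 1.
Proof.
move=> bV pb; rewrite dot_wedge (_ : \matrix_(i, j) _ = 1%:M) ?det1 //.
apply/matrixP => i j; rewrite !mxE (onb_nth bV) ?(leq_trans _ pb) //.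
by rewrite eq_sym.
Qed.

(** Let B hold the coordinates of vectors v_i of V in the basis b.  Then
v_1 ^ ... ^ v_p = det B . E, where E is the wedge of the basis: the difference
has norm zero because <v, v> = |det B|^2, <v, E> = det B and <E, E> = 1. *)
Lemma ext_power_dim p V b : onb dotX V b -> p = \dim V ->
  ext p V = <[wedge (fun i : 'I_p => b`_i)]>%VS.
Proof.
move=> bV pV; have sb := onb_size bV; set E := wedge _.
have E1 : gdot Lambda E E = 1 by rewrite (dot_wedge_onb bV) // sb pV.
have bi (i : 'I_p) : b`_i \in V by rewrite (onb_mem bV) // mem_nth // sb -pV.
apply/eqP; rewrite eqEsubv -memvE wedge_in // andbT.
apply: ext_power_sub => v vV; apply/vlineP.
pose B := \matrix_(i < p, k < p) dotX (v i) b`_k.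
have dxE : gdot Lambda (wedge v) E = \det B.
  rewrite dot_wedge -det_tr; congr (\det _).
  by apply/matrixP => i j; rewrite !mxE.
have dxx : gdot Lambda (wedge v) (wedge v) = conj (\det B) * \det B.
  rewrite dot_wedge -det_map_mx -[X in _ * X]det_tr -det_mulmx; congr (\det _).
  apply/matrixP => i j; rewrite !mxE -{1}(orthproj_id bV (vV j)) dot_orthproj.
  rewrite (big_nth 0) big_mkord sb -pV; apply: eq_bigr => k _.
  by rewrite !mxE mulrC -dotC.
exists (\det B); apply/eqP; rewrite -subr_eq0 -(dot_eq0 (gdot Lambda)).
rewrite dotBl !dotBr !dotZl !dotZr E1 dxx dxE (dotC _ E) dxE mulr1.
by rewrite subrr mulrC subrr subr0.
Qed.

(** For a wedge of vectors of W the two sides are determinants whose rows i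
differ by the factor s_i; the identity extends by linearity to their span. *)
Lemma dot_wedge_scaled p W (e f : 'I_p -> X) (s : 'I_p -> K) :
  (forall i, {in W, forall w, dotX w (e i) = s i * dotX w (f i)}) ->
  {in ext p W, forall y,
    gdot Lambda y (wedge e) = \prod_i s i * gdot Lambda y (wedge f)}.
Proof.
move=> ef y yW; set c := \prod_i s i.
have wZ (w : 'I_p -> X) : (forall i, w i \in W) ->
    gdot Lambda (wedge w) (wedge e) = c * gdot Lambda (wedge w) (wedge f).
  move=> wW; rewrite !dot_wedge.
  have -> : \matrix_(i, j) dotX (w j) (e i) =
      diag_mx (\row_i s i) *m \matrix_(i, j) dotX (w j) (f i).
    by apply/matrixP => i j; rewrite mul_diag_mx !mxE ef.
  rewrite det_mulmx det_diag; congr (_ * _).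
  by apply: eq_bigr => i _; rewrite mxE.
apply/eqP; rewrite -subr_eq0 -[c](conjK hK) -dotZr -dotBr.
suff /subvP/(_ y yW) : (ext p W <=
    orthov (gdot Lambda) <[wedge e - conj c *: wedge f]>)%VS by rewrite mem_perp.
apply: ext_power_sub => w wW; rewrite mem_perp dotBr dotZr (conjK hK).
by rewrite subr_eq0 wZ.
Qed.

End GrassmannAlgebra.

(** * The Grassmann angle as an angle of a line *)

Theorem theorem3p11 (R : realType) (K : numFieldType)
    (conj : {rmorphism K -> K}) (ofR : R -> K)
    (hK : real_or_complex conj ofR)
    (X : vectType K) (dotX : {dot X for conj})
    (Lambda : grassmann_algebra dotX)
    (V W : {vspace X}) (p : nat) (hp : p = \dim V) :
  grassmann_angle ofR dotX V W =
  line_angle ofR (gdot Lambda)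
    (ext_power (ginj Lambda) p V) (ext_power (ginj Lambda) p W).
Proof.
have [VW|WV] := leqP (\dim V) (\dim W); last first.
  rewrite /line_angle (ext_power_gt_dim hK Lambda (p := p)) ?hp // eqxx.
  rewrite /grassmann_angle (leqNgt (\dim V)) WV /= if_same.
  by case: eqP WV => // ->; rewrite dimv0 ltn0.
(* For V = 0 the Grassmann angle is 0 by convention, which agrees with the
   arc cosine of the empty product. *)
have [theta th thE] : exists2 theta, is_principal_angles ofR dotX V W theta &
    grassmann_angle ofR dotX V W = acos (\prod_(t <- theta) cos t).
  have [theta0 th0] := principal_angles_exist hK dotX VW.
  have [V0|V0] := eqVneq V 0%VS.
    exists theta0 => //; rewrite /grassmann_angle V0 eqxx.
    have [] := th0; rewrite V0 dimv0 min0n => /size0nil -> _ _ _.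
    by rewrite big_nil acos1.
  exists (principal_angles ofR dotX V W).
    by rewrite /principal_angles; case: xgetP => // /(_ theta0).
  rewrite /grassmann_angle (negPf V0) VW; case: eqP => // W0.
  by rewrite W0 dimv0 leqn0 dimv_eq0 (negPf V0) in VW.
have [e [f [eV fW ef]]] := principal_vectors VW th.
have [size_th _ th_bound _] := th; rewrite (minn_idPl VW) -hp in size_th.
have se := onb_size eV; have sf := onb_size fW.
rewrite thE; symmetry.
have EV := ext_power_dim Lambda eV hp.
have [pe pf] : (p <= size e /\ p <= size f)%N by rewrite se sf hp.
have E1 := dot_wedge_onb Lambda eV pe.
have F1 := dot_wedge_onb Lambda fW pf.
apply: (line_angle_eq hK _ _ E1 _ F1).
- by rewrite EV dim_vline -(dot_eq0 (gdot Lambda)) E1 oner_eq0.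
- by rewrite EV memv_line.
- apply: wedge_in => i; rewrite (onb_mem fW) // mem_nth // sf.
  by rewrite (leq_trans _ VW) // -hp.
- rewrite big_seq prodr_ge0 // => t /th_bound /andP[t0 t1].
  by rewrite cos_ge0_pihalf // t1 (le_trans _ t0) // oppr_le0 divr_ge0 ?pi_ge0.
move=> y yW; rewrite (ofR_prod hK) (big_nth 0) size_th big_mkord.
apply: (dot_wedge_scaled hK) yW => i w wW.
by rewrite ef // -hp.
Qed.
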